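(* For every $\epsilon>0$ there is a constant $C_\epsilon>0$ with the following property. Let $f(X)\in\mathbb{Z}[X]$ be a monic polynomial of degree $D$ such that, for some integers $m\ge 2$ and $n\ge\max\{\epsilon D,2\}$, the polynomial $f(X)$ is divisible by $X^{n-1}+X^{n-2}+\cdots+X+1$ in $(\mathbb{Z}/m\mathbb{Z})[X]$. Suppose further that no root of $f(X)$ (in $\bar{\mathbb{Q}}$) is a root of unity. Then $$\sum_{f(\alpha)=0} h(\alpha)\ \ge\ C_\epsilon\log m .$$ In particular, Lehmer's conjecture is true for this class of polynomials, i.e. for each fixed $\epsilon>0$ there is a constant $C>0$ such that $\sum_{f(\alpha)=0}h(\alpha)\ge C$ for all monic polynomials $f(X)\in\mathbb{Z}[X]$ having no root in $\bar{\mathbb{Q}}$ that is a root of unity and for which there exist integers $m\ge 2$ and $n\ge\max\{\epsilon\deg(f),2\}$ such that $f(X)$ is divisible by $X^{n-1}+X^{n-2}+\cdots+X+1$ in $(\mathbb{Z}/m\mathbb{Z})[X]$.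
   Context: $h:\bar{\mathbb{Q}}\to[0,\infty)$ is the absolute logarithmic (Weil) height: for $\alpha$ in a number field $K$, $h(\alpha)=\sum_{v\in M_K}\max\{\log\|\alpha\|_v,0\}$, where $M_K$ is the set of absolute values on $K$ extending the usual absolute values of $\mathbb{Q}$ and $\|\alpha\|_v=|\alpha|_v^{[K_v:\mathbb{Q}_v]/[K:\mathbb{Q}]}$. Sums over the roots of $f$ are over the roots in $\bar{\mathbb{Q}}$ counted with multiplicity. *)

(* Defs.v *)
From mathcomp Require Import all_boot all_order all_algebra all_field.
From mathcomp Require Import all_classical all_reals all_analysis.

Set Implicit Arguments.
Unset Strict Implicit.
Unset Printing Implicit Defensive.

Import Order.TTheory GRing.Theory Num.Theory.

Local Open Scope classical_set_scope.
Local Open Scope ring_scope.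

(* The p-adic absolute value on rat, normalised by |p|_p = 1/p. *)
Definition padic_abs (R : realType) (p : nat) (q : rat) : R :=
  if q == 0 then 0
  else p%:R ^+ logn p `|denq q|%N / p%:R ^+ logn p `|numq q|%N.

Definition absolute_value (R : realType) (K : fieldType) (v : K -> R) : Prop :=
  [/\ forall x, 0 <= v x,
      forall x, v x = 0 <-> x = 0,
      forall x y, v (x * y) = v x * v y
    & forall x y, v (x + y) <= v x + v y].

(* M_K. Here q%:A is the image of q : rat in K. *)
Definition places (R : realType) (K : fieldExtType rat) : set (K -> R) :=
  [set v | absolute_value v /\
    ((forall q : rat, v q%:A = ratr `|q|) \/
     (exists2 p : nat, prime p & forall q : rat, v q%:A = padic_abs R p q))].

Definition cauchy_seq (R : realType) (K : fieldType) (v : K -> R)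
    (x : nat -> K) : Prop :=
  forall e : R, 0 < e ->
    exists N : nat, forall i j : nat, (N <= i)%N -> (N <= j)%N -> v (x i - x j) < e.

Definition null_seq (R : realType) (K : fieldType) (v : K -> R)
    (x : nat -> K) : Prop :=
  forall e : R, 0 < e -> exists N : nat, forall i : nat, (N <= i)%N -> v (x i) < e.

Definition restr_rat (R : realType) (K : fieldExtType rat) (v : K -> R) : rat -> R :=
  fun q => v q%:A.

(* The completion K_v is the ring of v-Cauchy sequences of K modulo the null
   sequences, and Q_v is the same construction on Q for the restriction of v.
   The predicate says, on representatives, that the classes of
   e_0, ..., e_(d-1) form a basis of K_v as a Q_v-vector space. *)
Definition completion_basis (R : realType) (K : fieldExtType rat) (v : K -> R)
    (d : nat) (e : 'I_d -> nat -> K) : Prop :=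
  [/\ forall k, cauchy_seq v (e k),
      forall x : nat -> K, cauchy_seq v x ->
        exists c : 'I_d -> nat -> rat,
          (forall k, cauchy_seq (restr_rat v) (c k)) /\
          null_seq v (fun i => x i - \sum_(k < d) c k i *: e k i)
    & forall c : 'I_d -> nat -> rat,
        (forall k, cauchy_seq (restr_rat v) (c k)) ->
        null_seq v (fun i => \sum_(k < d) c k i *: e k i) ->
        forall k, null_seq (restr_rat v) (c k)].

(* [K_v : Q_v] *)
Definition local_degree (R : realType) (K : fieldExtType rat) (v : K -> R) : nat :=
  xget 0%N [set d | exists e : 'I_d -> nat -> K, completion_basis v e].

(* ||x||_v *)
Definition normalized_abs (R : realType) (K : fieldExtType rat) (v : K -> R)
    (x : K) : R :=
  v x `^ ((local_degree v)%:R / (\dim {:K})%:R).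

(* An unordered sum of nonnegative terms, taken in [0, +oo]. Since ln 0 = 0 in
   the library, the terms for x = 0 vanish, as with max (log 0) 0 = 0. *)
Definition height_in (R : realType) (K : fieldExtType rat) (x : K) : \bar R :=
  \esum_(v in @places R K) (Num.max (ln (normalized_abs v x)) 0)%:E.

(* The Weil height on algC, computed in the number field Q(a) and at the element
   of that field which is sent to a. *)
Definition weil_height (R : realType) (a : algC) : \bar R :=
  let: existT K (existT _ (exist2 s _ _)) := num_field_exists [:: a] in
  @height_in R K (head 0 s).

(* The roots of f in algC, with multiplicity. *)
Definition algC_roots (f : {poly int}) : seq algC :=
  sval (closed_field_poly_normal (map_poly (intr : int -> algC) f)).

Definition no_root_of_unity (f : {poly int}) : Prop :=
  forall a : algC, root (map_poly (intr : int -> algC) f) a ->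
    forall k : nat, (0 < k)%N -> ~~ k.-unity_root a.

(* Stated with an explicit cofactor because 'Z_m need not be a domain. It is only
   meant for 1 < m, as 'Z_0 and 'Z_1 are both Z/2Z. *)
Definition divisible_mod (m n : nat) (f : {poly int}) : Prop :=
  exists g : {poly 'Z_m},
    map_poly (intr : int -> 'Z_m) f = g * \sum_(i < n) 'X^i.

(* Main.v *)
(** Write [Phi = 1 + X + ... + X^(n-1)] and let [A] be the companion matrix of
    [f]. If [u] lies, like [f], in the ideal [(Phi, m)] of [Z[X]], then
    [m^(n-1)] divides [Res(f, u) = det u(A)]. Both [Phi] and all the polynomials
    [1 + Y + ... + Y^(m-1)] with [Y = X^(n m^j)] are in that ideal, the latter
    because they are congruent to [m] modulo [Y - 1], a multiple of [Phi]. Their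
    product over [j < k] times [X - 1] is [X^N - 1], where [N = n m^k], so
    [m^((k+1)(n-1))] divides [Res(f, X^N - 1)]. This resultant is nonzero as no
    root is a root of unity, and it is at most [2^D M(f)^N] in absolute value,
    [M] being the Mahler measure. For large [m] the case [k = 0] gives the bound; for the finitely
    many other [m] one takes [k] large with respect to [1/eps].

    The heights are compared with [log M(f)] through the archimedean places
    alone. Only a lower bound up to a constant is needed, so it suffices to know
    that local degrees are positive, and to keep one of the two closed half
    planes, on which distinct conjugates define distinct places. *)

Require Import Defs.
From mathcomp Require Import all_boot all_order all_algebra all_field.
From mathcomp Require Import all_classical all_reals all_analysis.
From mathcomp Require Import complex ring lra zify.

Set Implicit Arguments.
Unset Strict Implicit.
Unset Printing Implicit Defensive.

Import Order.TTheory GRing.Theory Num.Theory.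

Local Open Scope ring_scope.

(** * Determinants of polynomials in a companion matrix, modulo powers of [m] *)

(** Completing [T] by the last [r] unit columns gives a lower unitriangular matrix [T']. The first
    [n] columns of [M *m T'] are divisible by [m], and its determinant is that of [M]. *)
Lemma det_dvd_of_mul_unitri (R : comNzRingType) (n r : nat) (M : 'M[R]_(n + r))
    (T S : 'M[R]_(n + r, n)) (m : R) :
  usubmx T = 1%:M -> M *m T = m *: S -> exists c, \det M = c * m ^+ n.
Proof.
move=> T1 MT.
pose T' := row_mx T (col_mx 0 1%:M : 'M[R]_(n + r, r)).
have T'1 : \det T' = 1.
  rewrite /T' -[T]vsubmxK T1 -block_mxEh det_lblock !det1 mulr1 //.
exists (\det (row_mx S (M *m (col_mx 0 1%:M : 'M[R]_(n + r, r))))).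
have -> : \det M = \det (M *m T') by rewrite det_mulmx T'1 mulr1.
rewrite mul_mx_row MT.
have -> : m ^+ n = \det (block_mx m%:M 0 0 1%:M : 'M[R]_(n + r)).
  by rewrite det_ublock det1 mulr1 det_scalar.
by rewrite -det_mulmx mul_row_block !mulmx0 mulmx1 addr0 add0r mul_mx_scalar.
Qed.

(** For monic [f] of degree [d.+1], row [i] holds the coordinates of [X * X^i] modulo [f] in the
    basis of powers of [X]. Fixing the entries lets the size be [d.+1], whereas that of
    [companionmx f] is [(size f).-1]. *)
Definition is_companion (R : nzRingType) (d : nat) (f : {poly R}) (A : 'M[R]_d.+1) :=
  forall i j, A i j = if i == d :> nat then - f`_j else (i.+1 == j :> nat)%:R.

Lemma companion_exists (R : comNzRingType) (f : {poly R}) (d : nat) :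
  f \is monic -> size f = d.+2 ->
  exists2 A : 'M[R]_d.+1, char_poly A = f & is_companion f A.
Proof.
move=> fm sf; have eA (i j : 'I_(size f).-1) : companionmx f i j =
    if i == (size f).-2 :> nat then - f`_j else (i.+1 == j :> nat)%:R by rewrite mxE.
move: (companionmx f) (companionmxK fm) eA; rewrite sf /= => A cA eA.
by exists A.
Qed.

Lemma horner_mx_sum (R : comNzRingType) (n : nat) (A : 'M[R]_n.+1) (p : {poly R}) :
  horner_mx A p = \sum_(i < size p) p`_i *: A ^+ i.
Proof.
rewrite -{1}[p]coefK poly_def rmorph_sum; apply: eq_bigr => i _.
by rewrite /= linearZ /= rmorphXn /= horner_mx_X.
Qed.

Lemma companion_row0 (R : comNzRingType) (n : nat) (P : {poly R})
    (B : 'M[R]_n.+1) (i : 'I_n.+1) :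
  is_companion P B -> row 0 (B ^+ i) = delta_mx 0 i.
Proof.
move=> cB; case: i => i ilt; elim: i ilt => [|i IH] ilt.
  rewrite expr0; apply/rowP => j; by rewrite !mxE /= -!val_eqE /= eq_sym.
rewrite exprSr -mulmxE; have ilt' := ltnW ilt.
rewrite row_mul (IH ilt') -rowE; apply/rowP => j; rewrite !mxE cB /= ltn_eqF //.
by rewrite -val_eqE /= eq_sym.
Qed.

(** The matrix with rows [row 0 (B ^+ i)] expresses [X^i] modulo [P] for [i <= d]. Multiplication by
    [X] commutes with this reduction except in the last row, where [A] replaces [X^(d+1)] by
    [X^(d+1) - f]; the error is [- f], which is [- m *: h] modulo [P]. *)
Lemma companion_intertwine (d n : nat) (f P g h : {poly int}) (m : int)
    (A : 'M[int]_d.+1) (B : 'M[int]_n.+1) :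
  f \is monic -> size f = d.+2 -> f = g * P + m *: h ->
  is_companion f A -> char_poly B = P -> is_companion P B ->
  exists E, A *m (\matrix_(i < d.+1) row 0 (B ^+ i)) =
            (\matrix_(i < d.+1) row 0 (B ^+ i)) *m B + m *: E.
Proof.
move=> fm sf ef cA pB cB.
have fB : horner_mx B f = m *: horner_mx B h.
  by rewrite ef rmorphD rmorphM /= -pB Cayley_Hamilton mulr0 add0r linearZ.
exists (\matrix_(i < d.+1) if i == d :> nat then - row 0 (horner_mx B h) else 0).
set T := \matrix_i _; apply/row_matrixP => i.
rewrite linearD linearZ /= !row_mul !rowK -[row 0 _ *m B]row_mul.
rewrite (_ : B ^+ i *m B = B ^+ i.+1) ?exprSr ?mulmxE //.
have [ed|nd] := eqVneq (i : nat) d.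
  have -> : row i A *m T = row 0 (- \sum_(j < d.+1) f`_j *: B ^+ j).
    rewrite mulmx_sum_row linearN linear_sum /= -sumrN; apply: eq_bigr => j _.
    by rewrite rowK mxE cA ed eqxx linearZ /= scaleNr.
  rewrite ed scalerN -[m *: row _ _]linearZ /= -fB horner_mx_sum sf.
  rewrite [X in _ - row 0 X]big_ord_recr /=.
  have -> : f`_d.+1 = 1 by move/monicP: fm; rewrite lead_coefE sf.
  rewrite scale1r exprSr [row 0 (_ + _)]linearD.
  by rewrite [row 0 (- _)]linearN /= opprD addrCA subrr addr0.
have ilt : (i.+1 < d.+1)%N by have := ltn_ord i; lia.
rewrite scaler0 addr0.
suff -> : row i A = delta_mx 0 (Ordinal ilt) by rewrite -rowE rowK exprSr.
by apply/rowP => j; rewrite !mxE cA (negPf nd) -val_eqE /= eq_sym.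
Qed.

(* Modulo [m], [P] divides [f], and [u(A)] kills the quotient [Z[X]/P] of [Z[X]/f]. *)
Lemma dvd_det_horner (d n : nat) (f P g h u w k : {poly int}) (m : int)
    (A : 'M[int]_d.+1) :
  (n <= d)%N -> f \is monic -> size f = d.+2 -> is_companion f A ->
  P \is monic -> size P = n.+2 ->
  f = g * P + m *: h -> u = w * P + m *: k ->
  exists c, \det (horner_mx A u) = c * m ^+ n.+1.
Proof.
move=> nd fm sf cA Pm sP ef eu.
have [B pB cB] := companion_exists Pm sP.
have [E eE] := companion_intertwine fm sf ef cA pB cB.
move: eE; set T := \matrix_i _ => eE.
have [r er] : exists r, d = (n + r)%N by exists (d - n)%N; lia.
(* The intertwining modulo [m] passes from [X] to every polynomial [v], by Horner induction. *)
have comm v : exists S, horner_mx A v *m T = T *m horner_mx B v + m *: S.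
  elim/poly_ind: v => [|v c [S eS]].
    by exists 0; rewrite !rmorph0 mul0mx mulmx0 scaler0 addr0.
  exists (horner_mx A v *m E + S *m B).
  rewrite !rmorphD !rmorphM /= !horner_mx_X !horner_mx_C.
  rewrite mulmxDl mulmxDr -!mulmxE mul_scalar_mx mul_mx_scalar addrAC; congr (_ + _).
  rewrite -mulmxA eE mulmxDr [_ *m (_ *m B)]mulmxA eS mulmxDl -!scalemxAr -!scalemxAl.
  by rewrite mulmxA scalerDr -!addrA [_ *: _ + _ *: _]addrC.
have [S eS] := comm u.
have uB : horner_mx B u = m *: horner_mx B k.
  by rewrite eu rmorphD rmorphM /= -pB Cayley_Hamilton mulr0 add0r linearZ.
have {}eS : horner_mx A u *m T = m *: (T *m horner_mx B k + S).
  by rewrite eS uB -scalemxAr scalerDr.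
clear eE comm; subst d.
(* Since [n <= d], the first [n.+1] rows of [T] are the coordinates of [1, ..., X^n], which are
   already reduced modulo [P]. *)
apply: (@det_dvd_of_mul_unitri _ n.+1 r (horner_mx A u) T _ m _ eS).
apply/matrixP => i j; have /rowP/(_ j) := companion_row0 i cB.
by rewrite !mxE /= eq_sym.
Qed.

(** * Resultants as products over roots *)

Lemma det_sub_scalar (F : comNzRingType) (n : nat) (A : 'M[F]_n) (s : seq F) (b : F) :
  char_poly A = \prod_(a <- s) ('X - a%:P) -> \det (A - b%:M) = \prod_(a <- s) (a - b).
Proof.
move=> cA; have sz : size s = n.
  by apply/eqP; rewrite -eqSS -(size_prod_XsubC s id) -cA size_char_poly.
have -> : A - b%:M = -1 *: (b%:M - A) by rewrite scaleN1r opprB.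
rewrite detZ; have -> : \det (b%:M - A) = (char_poly A).[b].
  rewrite -[RHS]/(horner_eval b (\det _)) -det_map_mx; congr (\det _).
  apply/matrixP => i j; rewrite !mxE /= /horner_eval.
  by rewrite hornerD hornerN hornerMn hornerX hornerC.
have -> : (-1) ^+ n = \prod_(a <- s) (-1 : F).
  by rewrite big_const_seq count_predT sz iter_mulr_1.
rewrite cA horner_prod -big_split /=.
by apply: eq_bigr => a _; rewrite !hornerE mulN1r opprB.
Qed.

(** Factoring [u] rather than [f] reduces the identity to [det (A - b)], which is a value of the
    characteristic polynomial up to sign. Exchanging the two products concludes. *)
Lemma det_horner_prod (F : idomainType) (d : nat) (A : 'M[int]_d.+1) (u : {poly int})
    (s t : seq F) :
  map_poly intr (char_poly A) = \prod_(a <- s) ('X - a%:P) ->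
  map_poly intr u = \prod_(b <- t) ('X - b%:P) ->
  (\det (horner_mx A u))%:~R = \prod_(a <- s) (map_poly intr u).[a].
Proof.
move=> fs ut; rewrite -det_map_mx map_horner_mx ut rmorph_prod /=.
under [RHS]eq_bigr do rewrite horner_prod.
rewrite exchange_big /= (big_morph _ (@det_mulmx _ _) (det1 _ _)).
apply: eq_bigr => b _; rewrite rmorphB /= horner_mx_X horner_mx_C.
rewrite (@det_sub_scalar _ _ _ s) -?map_char_poly //.
by apply: eq_bigr => a _; rewrite !hornerE.
Qed.

(** * The resultant of [f] with [X^N - 1] *)

Lemma size_geometric_poly (R : nzRingType) (n : nat) :
  size (\sum_(i < n.+1) 'X^i : {poly R}) = n.+1.
Proof.
rewrite -[RHS](@size_poly_eq R n.+1 (fun=> 1)) ?oner_eq0 // poly_def.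
by under [in RHS]eq_bigr do rewrite scale1r.
Qed.

Lemma geometric_poly_monic (R : nzRingType) (n : nat) :
  (\sum_(i < n.+1) 'X^i : {poly R}) \is monic.
Proof.
rewrite monicE lead_coefE size_geometric_poly /= coef_sum big_ord_recr /= coefXn eqxx.
by rewrite big1 ?add0r // => i _; rewrite coefXn gtn_eqF.
Qed.

Section Resultant.

Variables (d n m : nat) (f g h : {poly int}) (A : 'M[int]_d.+1).
Let Phi : {poly int} := \sum_(i < n.+2) 'X^i.
Hypotheses (nd : (n <= d)%N) (fm : f \is monic) (sf : size f = d.+2).
Hypothesis (cA : is_companion f A).
Hypothesis fPhi : f = g * Phi + m%:Z *: h.

(** Here [n.+2] is the exponent [n] of the overview, so [Phi] has degree [n.+1]. Induction on [k]:
    passing from [Y - 1] to [Y^m - 1] brings in the factor [1 + Y + ... + Y^(m-1)] of the ideal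
    [(Phi, m)], hence another [m^(n+1)]. *)
Lemma dvd_det_Xn_sub1 (k : nat) :
  exists c, \det (horner_mx A ('X^(n.+2 * m ^ k) - 1)) = c * m%:Z ^+ (k.+1 * n.+1).
Proof.
have dvd u w r : u = w * Phi + m%:Z *: r ->
    exists c, \det (horner_mx A u) = c * m%:Z ^+ n.+1.
  exact: (dvd_det_horner nd fm sf cA (geometric_poly_monic _ _)
           (size_geometric_poly _ _) fPhi).
elim: k => [|k [c IH]].
  have [c e] : exists c, \det (horner_mx A Phi) = c * m%:Z ^+ n.+1.
    by apply: (dvd _ 1 0); rewrite scaler0 addr0 mul1r.
  exists (\det (horner_mx A ('X - 1)) * c).
  by rewrite muln1 mul1n subrX1 rmorphM /= -mulmxE det_mulmx e mulrA.
pose Y : {poly int} := 'X^(n.+2 * m ^ k).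
have [c' e] : exists c, \det (horner_mx A (\sum_(i < m) Y ^+ i)) = c * m%:Z ^+ n.+1.
  pose w : {poly int} := ('X - 1) * (\sum_(j < m ^ k) ('X^(n.+2)) ^+ j).
  have eY : Y - 1 = w * Phi by rewrite /Y exprM subrX1 subrX1 /w mulrAC.
  (* Each [Y^i] is [1 + (Y - 1)(1 + ... + Y^(i-1))], and [Y - 1 = w * Phi]; the [m] ones add up to
     [m]. *)
  apply: (dvd _ (\sum_(i < m) (w * \sum_(l < i) Y ^+ l)) 1).
  have -> : m%:Z *: (1 : {poly int}) = \sum_(i < m) 1.
    by rewrite sumr_const card_ord -natz scaler_nat.
  rewrite mulr_suml -big_split /=.
  by apply: eq_bigr => i _; rewrite mulrAC -eY -subrX1 subrK.
exists (c * c'); rewrite expnSr mulnA exprM subrX1 rmorphM /= -mulmxE det_mulmx e IH.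
by rewrite mulrACA -exprD -mulSnr.
Qed.

End Resultant.

(** The field is left open: over [algC] this shows that the resultant is nonzero, over [R[i]] it
    bounds its size. *)
Lemma det_Xn_sub1 (F : closedFieldType) (d N : nat) (A : 'M[int]_d.+1) (s : seq F) :
  (0 < N)%N -> map_poly intr (char_poly A) = \prod_(a <- s) ('X - a%:P) ->
  (\det (horner_mx A ('X^N - 1)))%:~R = \prod_(a <- s) (a ^+ N - 1).
Proof.
move=> N0 As; have [t] := closed_field_poly_normal ('X^N - 1 : {poly F}).
have -> : lead_coef ('X^N - 1 : {poly F}) = 1 by rewrite lead_coefXnsubC.
rewrite scale1r => Nt.
have eN : map_poly intr ('X^N - 1) = 'X^N - 1 :> {poly F}.
  by rewrite rmorphB /= map_polyXn rmorph1.
rewrite (@det_horner_prod _ _ _ _ s t) ?eN //.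
by apply: eq_bigr => a _; rewrite !hornerE.
Qed.

(** * Upper bound for the resultant by the Mahler measure *)

(** This is [log^+ |z|], including [z = 0] since [ln 0 = 0]. Its sum over the roots of a monic
    polynomial is the logarithm of the Mahler measure. *)
Definition log_plus (R : realType) (z : R[i]) : R := Num.max (ln (Normc.normc z)) 0.

Lemma log_plus_ge0 (R : realType) (z : R[i]) : 0 <= log_plus z.
Proof. by rewrite le_max lexx orbT. Qed.

Lemma normc_ge0 (R : realType) (z : R[i]) : 0 <= Normc.normc z.
Proof. by case: z => a b; rewrite sqrtr_ge0. Qed.

Lemma normc_le_expR (R : realType) (z : R[i]) : Normc.normc z <= expR (log_plus z).
Proof.
have [z0|z0] := eqVneq (Normc.normc z) 0; first by rewrite z0 expR_ge0.
have z1 : 0 < Normc.normc z by rewrite lt_def z0 normc_ge0.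
by rewrite -[X in X <= _]lnK ?posrE // ler_expR le_max lexx.
Qed.

(** Both [|z|^N] and [1] are at most [max(1, |z|)^N]. *)
Lemma normc_Xn_sub1 (R : realType) (z : R[i]) (N : nat) :
  Normc.normc (z ^+ N - 1) <= expR (ln 2 + N%:R * log_plus z).
Proof.
have zN : Normc.normc (z ^+ N) = Normc.normc z ^+ N.
  by elim: N => [|N IH]; rewrite ?Normc.normc1 // !exprS Normc.normcM IH.
have e1 : 1 <= expR (N%:R * log_plus z).
  by rewrite -expR0 ler_expR mulr_ge0 // log_plus_ge0.
apply: le_trans (le_normcD _ _) _; rewrite normcN Normc.normc1 zN expRD lnK ?posrE //.
have : Normc.normc z ^+ N <= expR (N%:R * log_plus z).
  by rewrite mulrC expRM_natr lerXn2r ?nnegrE ?normc_ge0 ?expR_ge0 ?normc_le_expR.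
lra.
Qed.

Lemma normc_int (R : realType) (c : int) : Normc.normc (c%:~R : R[i]) = `|c|%:~R.
Proof.
have -> : (c%:~R : R[i]) = (c%:~R : R)%:C%C by rewrite rmorph_int.
by rewrite /= expr0n addr0 sqrtr_sqr intr_norm.
Qed.

(** Logarithmic form of [m^((k+1)(n+1)) <= |Res(f, X^N - 1)| <= 2^(d+1) M(f)^N] with
    [N = (n+2) m^k]. *)
Lemma log_mahler_ge (R : realType) (d n m k : nat) (f g h : {poly int}) (s : seq R[i]) :
  (n <= d)%N -> (0 < m)%N -> f \is monic -> size f = d.+2 ->
  f = g * (\sum_(i < n.+2) 'X^i) + m%:Z *: h ->
  no_root_of_unity f ->
  map_poly intr f = \prod_(b <- s) ('X - b%:P) ->
  (k.+1 * n.+1)%:R * ln m%:R <=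
    d.+1%:R * ln 2 + (n.+2 * m ^ k)%:R * \sum_(b <- s) log_plus b.
Proof.
move=> nd m0 fm sf ef nru fs.
have [A fA cA] := companion_exists fm sf.
have N0 : (0 < n.+2 * m ^ k)%N by rewrite muln_gt0 expn_gt0 m0.
have [c ec] := dvd_det_Xn_sub1 nd fm sf cA ef k.
set N := (n.+2 * m ^ k)%N in N0 ec *.
have det0 : \det (horner_mx A ('X^N - 1)) != 0.
  have [t] := closed_field_poly_normal (map_poly (intr : int -> algC) f).
  rewrite lead_coef_map_inj ?(monicP fm) ?scale1r //; last exact: intr_inj.
  move=> ft; rewrite -(intr_eq0 algC) (@det_Xn_sub1 _ _ _ _ t) ?fA //.
  rewrite prodf_seq_neq0; apply/allP => a at_ /=; rewrite subr_eq0.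
  have := nru a; rewrite ft root_prod_XsubC => /(_ at_ N N0); by rewrite unity_rootE.
have sz : size s = d.+1.
  apply/eqP; rewrite -eqSS -(size_prod_XsubC s id) -fs size_map_poly_id0 ?sf //.
  by rewrite (monicP fm) oner_eq0.
have eN : Normc.normc ((\det (horner_mx A ('X^N - 1)))%:~R : R[i]) =
    Normc.normc (\prod_(b <- s) (b ^+ N - 1)).
  by congr Normc.normc; apply: det_Xn_sub1; rewrite ?fA.
rewrite normc_int in eN.
have prodE : Normc.normc (\prod_(b <- s) (b ^+ N - 1)) =
    \prod_(b <- s) Normc.normc (b ^+ N - 1).
  by apply: (big_morph _ (@Normc.normcM R) (Normc.normc1 R)).
have up : `|\det (horner_mx A ('X^N - 1))|%:~R <=
    expR (d.+1%:R * ln 2 + N%:R * \sum_(b <- s) log_plus b).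
  have -> : d.+1%:R * ln 2 + N%:R * \sum_(b <- s) log_plus b =
      \sum_(b <- s) (ln 2 + N%:R * log_plus b).
    by rewrite big_split /= mulr_sumr big_const_seq count_predT sz iter_addr_0 mulr_natl.
  rewrite eN prodE expR_sum; apply: ler_prod => b _.
  by rewrite normc_ge0 normc_Xn_sub1.
rewrite -ler_expR expRM_natl lnK ?posrE ?ltr0n //.
apply: le_trans up; rewrite ec -[m%:R ^+ _]mulr1 normrM normrX intrM mulrC.
have -> : `|m%:Z| ^+ (k.+1 * n.+1) = (m ^ (k.+1 * n.+1))%:Z.
  by rewrite ger0_norm // -!natz -natrX.
rewrite -natrX -[(Posz _)%:~R]/(_%:R) ler_wpM2r // ler1z.
rewrite -gtz0_ge1 normr_gt0; apply: contraNneq det0 => c0.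
by rewrite ec c0 mul0r.
Qed.

(** * Completions at archimedean places *)

(** The quantifiers are those of [null_seq] and, in [vanishing2], of [cauchy_seq], so that these
    become statements on the real sequences [v (x i)] and [v (x i - x j)]. *)
Definition vanishing (R : realType) (w : nat -> R) :=
  forall e : R, 0 < e -> exists N, forall i, (N <= i)%N -> w i < e.

Definition vanishing2 (R : realType) (w : nat -> nat -> R) :=
  forall e : R, 0 < e -> exists N, forall i j, (N <= i)%N -> (N <= j)%N -> w i j < e.

Lemma vanishing_dom (R : realType) (C : R) (w z : nat -> R) :
  0 < C -> (forall i, z i <= C * w i) -> vanishing w -> vanishing z.
Proof.
move=> C0 zw w0 e e0; have [N wN] := w0 (e / C) (divr_gt0 e0 C0).
exists N => i Ni; apply: le_lt_trans (zw i) _.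
by rewrite -ltr_pdivlMl // mulrC wN.
Qed.

Lemma vanishing2_dom (R : realType) (C : R) (w z : nat -> nat -> R) :
  0 < C -> (forall i j, z i j <= C * w i j) -> vanishing2 w -> vanishing2 z.
Proof.
move=> C0 zw w0 e e0; have [N wN] := w0 (e / C) (divr_gt0 e0 C0).
exists N => i j Ni Nj; apply: le_lt_trans (zw i j) _.
by rewrite -ltr_pdivlMl // mulrC wN.
Qed.

Lemma vanishingD (R : realType) (w z : nat -> R) :
  vanishing w -> vanishing z -> vanishing (fun i => w i + z i).
Proof.
move=> w0 z0 e e0; have e2 : 0 < e / 2 by lra.
have [N wN] := w0 _ e2; have [M zM] := z0 _ e2.
exists (maxn N M) => i; rewrite geq_max => /andP[Ni Mi].
by have := wN _ Ni; have := zM _ Mi; lra.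
Qed.

(** Real coordinates must be represented by rational Cauchy sequences: [c i] is taken within
    [1 / (i + 1)] of [y i]. *)
Lemma rat_cauchy_approx (R : realType) (y : nat -> R) :
  vanishing2 (fun i j => `|y i - y j|) ->
  exists c : nat -> rat,
    vanishing2 (fun i j => `|ratr (c i) - ratr (c j) : R|) /\
    vanishing (fun i => `|y i - ratr (c i)|).
Proof.
move=> yC.
have ex i : exists q : rat, `|y i - ratr q| < (i.+1%:R)^-1.
  have : 0 < (i.+1%:R : R)^-1 by rewrite invr_gt0.
  move: (_^-1) => r r0; have yr : y i - r < y i + r by lra.
  have [q] := rat_in_itvoo yr.
  by rewrite in_itv /= => /andP[q1 q2]; exists q; rewrite ltr_norml; lra.
have [c cP] := choice ex; exists c.
have c0 : vanishing (fun i => `|y i - ratr (c i)|).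
  move=> e /ltr_add_invr[N]; rewrite add0r => Ne; exists N => i Ni.
  apply: lt_trans (cP i) (le_lt_trans _ Ne).
  by rewrite lef_pV2 ?posrE ?ler_nat.
split=> // e e0; have e3 : 0 < e / 3 by lra.
have [N yN] := yC _ e3; have [M cM] := c0 _ e3.
exists (maxn N M) => i j; rewrite !geq_max => /andP[Ni Mi] /andP[Nj Mj].
have := yN _ _ Ni Nj; have := cM _ Mi; have := cM _ Mj.
by rewrite !ltr_norml; lra.
Qed.

Section Embedding.

Variables (R : realType) (K : fieldExtType rat) (sigma : K -> R[i]).

(** A predicate on plain functions, because embeddings are obtained below from the axiom of
    choice. *)
Definition is_embedding :=
  [/\ forall x y, sigma (x + y) = sigma x + sigma y,
      forall x y, sigma (x * y) = sigma x * sigma y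
    & forall q : rat, sigma q%:A = ratr q].

Hypothesis se : is_embedding.

Let v x := Normc.normc (sigma x).

Lemma embeddingZ (q : rat) (x : K) : sigma (q *: x) = ratr q * sigma x.
Proof. by case: se => _ sM sq; rewrite -mulr_algl sM sq. Qed.

Lemma embeddingB (x y : K) : sigma (x - y) = sigma x - sigma y.
Proof.
by case: se => sD _ _; rewrite -scaleN1r sD embeddingZ rmorphN1 mulN1r.
Qed.

Lemma complex_ratr (q : rat) : (ratr q : R[i]) = (ratr q)%:C%C.
Proof. by rewrite fmorph_rat. Qed.

Lemma normc_ratr (q : rat) : Normc.normc (ratr q : R[i]) = `|ratr q|.
Proof. by rewrite complex_ratr /= expr0n addr0 sqrtr_sqr. Qed.

Lemma restr_rat_embedding (q : rat) : restr_rat v q = `|ratr q|.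
Proof. by case: se => _ _ sq; rewrite /restr_rat /v sq normc_ratr. Qed.

Lemma embedding_place : places v.
Proof.
have [sD sM sq] := se.
split; last by left=> q; rewrite /v sq normc_ratr ratr_norm.
have s0 : sigma 0 = 0 by rewrite -(scale0r (0 : K)) embeddingZ rmorph0 mul0r.
split=> [x|x|x y|x y]; rewrite /v.
- exact: normc_ge0.
- split=> [/Normc.eq0_normc sx|->]; last by rewrite s0 Normc.normc0.
  apply/eqP/negPn/negP => x0; have := sq 1; rewrite scale1r -(mulfV x0) sM sx mul0r rmorph1.
  by move/eqP; rewrite eq_sym oner_eq0.
- by rewrite sM Normc.normcM.
- by rewrite sD le_normcD.
Qed.

Lemma norm_Re_le (z : R[i]) : `|complex.Re z| <= Normc.normc z.
Proof.
case: z => a b /=; rewrite -sqrtr_sqr ler_sqrt ?addr_ge0 ?sqr_ge0 //.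
by rewrite lerDl sqr_ge0.
Qed.

Lemma norm_Im_le (z : R[i]) : `|complex.Im z| <= Normc.normc z.
Proof.
case: z => a b /=; rewrite -sqrtr_sqr ler_sqrt ?addr_ge0 ?sqr_ge0 //.
by rewrite lerDr sqr_ge0.
Qed.

Lemma completion_basis_real :
  (forall x, complex.Im (sigma x) = 0) ->
  completion_basis v (fun (_ : 'I_1) (_ : nat) => 1).
Proof.
move=> sR; have vE x : v x = `|complex.Re (sigma x)|.
  by have := sR x; rewrite /v; case: (sigma x) => a b /= ->; rewrite expr0n addr0 sqrtr_sqr.
split=> [k e e0|x xC|c cC c0 k e e0].
- by exists 0%N => i j _ _; rewrite subrr; have [[_ /(_ 0)[_ ->]]] := embedding_place.
- have [c [cC xc]] : exists c : nat -> rat,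
    vanishing2 (fun i j => `|ratr (c i) - ratr (c j) : R|) /\
    vanishing (fun i => `|complex.Re (sigma (x i)) - ratr (c i)|).
    apply: rat_cauchy_approx => e e0; have [N xN] := xC e e0.
    exists N => i j Ni Nj; have := xN _ _ Ni Nj; rewrite vE embeddingB.
    by case: (sigma (x i)) (sigma (x j)) => [? ?] [? ?].
  exists (fun _ => c); split=> [_ e e0|e e0].
    have [N cN] := cC e e0; exists N => i j Ni Nj.
    by rewrite restr_rat_embedding rmorphB cN.
  have [N xN] := xc e e0; exists N => i Ni; have := xN _ Ni.
  rewrite big_ord1 vE embeddingB embeddingZ; have [_ _ /(_ 1)] := se.
  rewrite scale1r rmorph1 => ->; rewrite mulr1 complex_ratr.
  by case: (sigma (x i)).
- have [N cN] := c0 e e0; exists N => i Ni; have := cN _ Ni.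
  have [_ _ sq] := se.
  by rewrite (ord1 k) big_ord1 restr_rat_embedding /v sq normc_ratr.
Qed.

(** The coordinates [y0], [y1] of a complex number on the real basis [1, sigma a] are additive and
    bounded by multiples of the modulus. Thus they carry Cauchy sequences to Cauchy sequences, which
    gives generation, and null sequences to null sequences, which gives independence. *)
Lemma completion_basis_complex (a : K) :
  complex.Im (sigma a) != 0 ->
  completion_basis v (fun (k : 'I_2) (_ : nat) => if k == 0 then 1 else a).
Proof.
move=> q0; have [_ _ sq] := se.
have s1 : sigma 1 = 1 by have := sq 1; rewrite scale1r rmorph1.
set p := complex.Re (sigma a); set q := complex.Im (sigma a) in q0 *.
have q1 : 0 < `|q|^-1 by rewrite invr_gt0 normr_gt0.
have C1 : 0 < 1 + `|p| * `|q|^-1 by rewrite ltr_wpDr // mulr_ge0 // ltW.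
pose y1 z := complex.Im z / q; pose y0 z := complex.Re z - y1 z * p.
have y1B z w : y1 (z - w) = y1 z - y1 w.
  by case: z w => [? ?] [? ?]; rewrite /y1 /= mulrBl.
have y0B z w : y0 (z - w) = y0 z - y0 w.
  rewrite /y0 y1B; case: z w => [? ?] [? ?] /=; ring.
have y1_le z : `|y1 z| <= `|q|^-1 * Normc.normc z.
  by rewrite normrM normfV mulrC ler_pM2l // norm_Im_le.
have y0_le z : `|y0 z| <= (1 + `|p| * `|q|^-1) * Normc.normc z.
  rewrite mulrDl mul1r; apply: le_trans (ler_normB _ _) _.
  rewrite lerD ?norm_Re_le // normrM mulrC -mulrA ler_wpM2l // y1_le //.
have sE (c : 'I_2 -> rat) : sigma (\sum_(k < 2) c k *: (if k == 0 then 1 else a)) =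
    ratr (c 0) + ratr (c 1) * sigma a.
  rewrite 2!big_ord_recl big_ord0 addr0 /=; have [-> _ _] := se; rewrite !embeddingZ s1 mulr1.
  by congr (_ + ratr (c _) * _); apply: val_inj.
have yE z : z = (y0 z)%:C%C + (y1 z)%:C%C * sigma a.
  move: q0; rewrite /y0 /y1 /p /q; case: (sigma a) => u w /= w0.
  by case: z => r s; apply/eqP; rewrite eq_complex /=; apply/andP; split; apply/eqP; field.
have yr (r s : R) :
    (y0 (r%:C%C + s%:C%C * sigma a) = r) * (y1 (r%:C%C + s%:C%C * sigma a) = s).
  move: q0; rewrite /y0 /y1 /p /q; case: (sigma a) => u w /= w0.
  by split; field.
have cauchy_y (y : R[i] -> R) C x : 0 < C -> (forall z w, y (z - w) = y z - y w) ->
    (forall z, `|y z| <= C * Normc.normc z) -> cauchy_seq v x ->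
    exists c : nat -> rat,
      vanishing2 (fun i j => `|ratr (c i) - ratr (c j) : R|) /\
      vanishing (fun i => `|y (sigma (x i)) - ratr (c i)|).
  move=> C0 yB y_le xC; apply: rat_cauchy_approx.
  apply: (vanishing2_dom C0 _ xC) => i j.
  by rewrite -yB /v embeddingB.
split=> [k e e0|x xC|c cC c0].
- by exists 0%N => i j _ _; rewrite subrr; have [[_ /(_ 0)[_ ->]]] := embedding_place.
- have [c0 [c0C xc0]] := cauchy_y _ _ _ C1 y0B y0_le xC.
  have [c1 [c1C xc1]] := cauchy_y _ _ _ q1 y1B y1_le xC.
  exists (fun k => if k == 0 then c0 else c1); split=> [k e e0|].
    have [|] := boolP (k == 0) => _.
      have [N cN] := c0C e e0; exists N => i j Ni Nj.
      by rewrite restr_rat_embedding rmorphB cN.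
    have [N cN] := c1C e e0; exists N => i j Ni Nj.
    by rewrite restr_rat_embedding rmorphB cN.
  pose M := 1 + Normc.normc (sigma a).
  have M0 : 0 < M by rewrite ltr_wpDr // normc_ge0.
  apply: (vanishing_dom M0 _ (vanishingD xc0 xc1)) => i.
  rewrite /v embeddingB sE /= {1}[sigma (x i)]yE !complex_ratr.
  set r0 := y0 _; set r1 := y1 _.
  have -> : r0%:C%C + r1%:C%C * sigma a - ((ratr (c0 i))%:C%C + (ratr (c1 i))%:C%C * sigma a) =
     (r0 - ratr (c0 i))%:C%C + (r1 - ratr (c1 i))%:C%C * sigma a by rewrite !rmorphB /=; ring.
  apply: le_trans (le_normcD _ _) _; rewrite Normc.normcM.
  have nr (r : R) : Normc.normc r%:C%C = `|r| by rewrite /= expr0n addr0 sqrtr_sqr.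
  rewrite !nr /M; have := normc_ge0 (sigma a).
  have := normr_ge0 (r0 - ratr (c0 i)); have := normr_ge0 (r1 - ratr (c1 i)); nra.
- have c1E i : `|ratr (c 1 i)| <=
      `|q|^-1 * v (\sum_(k < 2) c k i *: (if k == 0 then 1 else a)).
    have := y1_le (sigma (\sum_(k < 2) c k i *: (if k == 0 then 1 else a))).
    by rewrite {1}(sE (c ^~ i)) !complex_ratr yr.
  have c0E i : `|ratr (c 0 i)| <=
      (1 + `|p| * `|q|^-1) * v (\sum_(k < 2) c k i *: (if k == 0 then 1 else a)).
    have := y0_le (sigma (\sum_(k < 2) c k i *: (if k == 0 then 1 else a))).
    by rewrite {1}(sE (c ^~ i)) !complex_ratr yr.
  move=> k; have [->|->] : k = 0 \/ k = 1.
  + by case: k => [[|[|?]] ?] //; [left|right]; apply: val_inj.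
  + by apply: (vanishing_dom C1 _ c0) => i; rewrite restr_rat_embedding.
  + by apply: (vanishing_dom q1 _ c0) => i; rewrite restr_rat_embedding.
Qed.

(** As [xget] falls back on [0], a basis has to be exhibited: one element for a real embedding, two
    otherwise. The degree chosen is then nonzero, since an empty basis would make the constant
    sequence [1] null. *)
Lemma local_degree_embedding_gt0 : (0 < local_degree v)%N.
Proof.
have ex : exists d, [set d | exists e : 'I_d -> nat -> K, completion_basis v e]%classic d.
  have [sR|/existsNP[a /eqP sa]] := pselect (forall x, complex.Im (sigma x) = 0).
    by exists 1%N; exists (fun _ _ => 1); apply: completion_basis_real.
  by exists 2%N; eexists; apply: completion_basis_complex sa.
have := xgetPex 0%N ex; rewrite /= -/(local_degree v) => -[e].
case: (local_degree v) e => // e [_ span _].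
have [_ _ /(_ 1)] := se; rewrite scale1r rmorph1 => s1.
have [e0 e00|c [_ /(_ 1 ltr01)[N /(_ N (leqnn N))]]] := span (fun=> 1).
  by exists 0%N => i j _ _; rewrite subrr; have [[_ /(_ 0)[_ ->]]] := embedding_place.
by rewrite big_ord0 subr0 /v s1 Normc.normc1 ltxx.
Qed.

Lemma log_normalized_abs_embedding (x : K) :
  log_plus (sigma x) / (\dim {:K})%:R <= Num.max (ln (normalized_abs v x)) 0.
Proof.
rewrite /normalized_abs ln_powR.
rewrite -[X in Num.max _ X](mulr0 ((local_degree v)%:R / (\dim {:K})%:R : R)).
rewrite -maxr_pMr; last by rewrite divr_ge0.
rewrite -/(log_plus (sigma x)) mulrAC -mulrA ler_peMl ?divr_ge0 ?log_plus_ge0 //.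
by rewrite ler1n local_degree_embedding_gt0.
Qed.

End Embedding.

(** * Archimedean part of the height over a number field *)

(** All terms of the height are nonnegative, so it may be restricted to the places [x |-> |sigma x|]
    given by the conjugates [b]. The condition on imaginary parts puts [s] in a closed half plane
    and makes these places distinct. *)
Lemma sum_log_plus_le_height_in (R : realType) (K : fieldExtType rat) (a : K) (s : seq R[i]) :
  uniq s ->
  (forall b, b \in s -> exists2 sigma : K -> R[i], is_embedding sigma & sigma a = b) ->
  {in s &, forall b c, 0 <= complex.Im b * complex.Im c} ->
  (((\sum_(b <- s) log_plus b) / (\dim {:K})%:R)%:E <= height_in R a)%E.
Proof.
move=> us emb sIm.
have ex (b : R[i]) : exists sg : K -> R[i], b \in s -> is_embedding sg /\ sg a = b.
  have [/emb[sg sge sga]|] := boolP (b \in s); first by exists sg.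
  by exists (fun=> 0).
have [sig sigP] := choice ex.
pose e b := fun x => Normc.normc (sig b x).
have e_inj : set_inj [set` s] e.
  (* The values at [a] and [a + 1] are [|b|] and [|b + 1|]; they determine the real part of [b] and
     the square of its imaginary part. *)
  move=> b c; rewrite !inE /= => bs cs /(congr1 (fun w => (w a, w (a + 1)))) [].
  have [[bD _ bq] ba] := sigP _ bs; have [[cD _ cq] ca] := sigP _ cs.
  rewrite /e bD cD ba ca; have := bq 1; have := cq 1; rewrite scale1r rmorph1 => -> ->.
  have := sIm _ _ bs cs; clear; case: b c => [u w] [u' w'] /= ww.
  rewrite /Normc.normc /=.
  move=> /(congr1 (fun x => x ^+ 2)); rewrite !sqr_sqrtr ?addr_ge0 ?sqr_ge0 // => e1.
  move=> /(congr1 (fun x => x ^+ 2)); rewrite !sqr_sqrtr ?addr_ge0 ?sqr_ge0 // => e2.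
  have uu : u = u' by lra.
  have : (w == w') || (w == - w').
    by rewrite -eqf_sqr; apply/eqP; move: e1; rewrite uu => /addrI.
  rewrite uu => /orP[/eqP->//|/eqP wN]; have w0 : w' = 0 by nra.
  by rewrite wN w0 oppr0.
have eP : ([set e b | b in [set` s]] `<=` @places R K)%classic.
  by move=> _ [b /= bs <-]; apply: embedding_place; have [] := sigP _ bs.
apply: (@le_trans _ _ (\esum_(v in [set e b | b in [set` s]]%classic)
    (Num.max (ln (normalized_abs v a)) 0)%:E)).
  rewrite esum_image // esum_fset //=.
  - rewrite -fsbig_seq // sumEFin lee_fin mulr_suml big_seq [leRHS]big_seq.
    apply: ler_sum => b bs; have [sge sga] := sigP _ bs.
    by have := log_normalized_abs_embedding sge a; rewrite sga.
  - by move=> b _; rewrite lee_fin le_max lexx orbT.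
rewrite /height_in esum_mkcond [leRHS]esum_mkcond; apply: le_esum => v _.
case: ifPn => [|_].
  by rewrite !inE => /eP vP; rewrite mem_set.
by case: ifP; rewrite // lee_fin le_max lexx orbT.
Qed.

(** * Minimal polynomials and conjugates *)

(* [g] is, up to a scalar, the minimal polynomial of [a] over [rat]. *)
Definition annihilator (a : algC) (g : {poly rat}) :=
  forall q, root (map_poly ratr q) a = (g %| q).

Lemma root_annihilator (a : algC) (g : {poly rat}) :
  annihilator a g -> root (map_poly ratr g) a.
Proof. by move=> ag; rewrite ag dvdpp. Qed.

Lemma size_annihilator (a : algC) (g : {poly rat}) :
  annihilator a g -> g != 0 -> (1 < size g)%N.
Proof.
move=> ag g0; rewrite -(size_map_poly (ratr : {rmorphism rat -> algC})).
by rewrite (root_size_gt1 (a := a)) ?map_poly_eq0 // root_annihilator.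
Qed.

(** Irreducibility of [g]: [a] is a root of [h] or of [k], and in the latter case [size g <= size k]
    leaves only a constant for [h]. *)
Lemma annihilator_factor (a : algC) (g h k : {poly rat}) :
  annihilator a g -> g != 0 -> g = k * h -> (g %| h) || (size h == 1)%N.
Proof.
move=> ag g0 gkh; have := root_annihilator ag.
rewrite {1}gkh rmorphM rootM !ag => /orP[gk|->//].
have /andP[k0 h0] : (k != 0) && (h != 0) by rewrite -negb_or -mulf_eq0 -gkh.
have := dvdp_leq k0 gk; rewrite {1}gkh size_mul //.
move: h0; rewrite -size_poly_gt0; case: (size h) => // [[|n]] _.
  by rewrite orbT.
by rewrite addnS /=; lia.
Qed.

Lemma annihilator_conj (a b : algC) (g : {poly rat}) :
  g \is monic -> annihilator a g -> root (map_poly ratr g) b -> annihilator b g.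
Proof.
move=> gm ag gb; have [h [_ hm bh]] := minCpolyP b.
have := gb; rewrite bh => /dvdpP[k gkh].
have := annihilator_factor ag (monic_neq0 gm) gkh.
rewrite (gtn_eqF (size_annihilator bh (monic_neq0 hm))) orbF => gh.
suff <- : h = g by [].
by apply/eqP; rewrite -eqp_monic // /eqp gh -bh gb.
Qed.

Lemma annihilator_separable (a : algC) (g : {poly rat}) :
  annihilator a g -> g != 0 -> separable_poly g.
Proof.
move=> ag g0; rewrite separable_poly.unlock /coprimep.
have /dvdpP[k gk] := dvdp_gcdl g g^`().
have sg := size_annihilator ag g0.
have [|//] := orP (annihilator_factor ag g0 gk).
rewrite dvdp_gcd dvdpp /= => gg'.
(* In characteristic zero, the leading coefficient survives differentiation. *)
have g'0 : g^`() != 0.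
  apply/negP => /eqP/(congr1 (fun p : {poly rat} => p`_(size g).-2)).
  rewrite coef_deriv coef0 => /eqP; rewrite mulrn_eq0 /=.
  have -> : (size g).-2.+1 = (size g).-1 by lia.
  by rewrite -lead_coefE lead_coef_eq0 (negPf g0).
by have := leq_ltn_trans (dvdp_leq g'0 gg') (lt_size_deriv g0); rewrite ltnn.
Qed.

(** * Embeddings of a number field generated by one element *)

Section NumberField.

Variables (R : realType) (K : fieldExtType rat) (iota : {rmorphism K -> algC}).
Variables (a : K) (g : {poly rat}).
Hypotheses (Ka : <<1 & [:: a]>>%VS = fullv) (ag : annihilator (iota a) g).

Lemma horner_eq0_annihilator (p : {poly rat}) :
  (map_poly (in_alg K) p).[a] = 0 -> g %| p.
Proof.
move=> pa; rewrite -ag /root; apply/eqP.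
have -> : map_poly ratr p = map_poly iota (map_poly (in_alg K) p).
  rewrite -map_poly_comp; apply: eq_map_poly => r /=.
  by rewrite alg_num_field fmorph_rat.
by rewrite horner_map pa rmorph0.
Qed.

(** Every [x] is [p(a)] for some rational [p], and is sent to [p(b)]. Two choices of [p] differ by a
    multiple of [g], which vanishes at [b]. *)
Lemma embedding_exists (b : R[i]) : root (map_poly ratr g) b ->
  exists2 sigma : K -> R[i], is_embedding sigma & sigma a = b.
Proof.
move=> gb.
have ex (x : K) : exists p, x = (map_poly (in_alg K) p).[a].
  by apply/Fadjoin1_polyP; rewrite -adjoin_seq1 Ka memvf.
have [P xP] := choice ex.
have wd p x : x = (map_poly (in_alg K) p).[a] ->
    (map_poly ratr (P x)).[b] = (map_poly ratr p).[b].
  move=> xp; have : g %| P x - p.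
    by apply: horner_eq0_annihilator; rewrite rmorphB hornerD hornerN -xP -xp subrr.
  move=> /dvdpP[k e]; apply/eqP.
  rewrite -subr_eq0 -hornerN -hornerD -rmorphB e rmorphM hornerM.
  by rewrite (rootP gb) mulr0.
exists (fun x => (map_poly ratr (P x)).[b]).
  split=> [x y|x y|q].
  - by rewrite (@wd (P x + P y)) rmorphD hornerD // -!xP.
  - by rewrite (@wd (P x * P y)) rmorphM hornerM // -!xP.
  - by rewrite (@wd q%:P) ?map_polyC ?hornerC.
by rewrite (@wd 'X) ?map_polyX ?hornerX.
Qed.

Lemma dim_annihilator_le : g != 0 -> (\dim {:K} <= (size g).-1)%N.
Proof.
move=> g0; rewrite -Ka adjoin_seq1 dim_Fadjoin dimv1 muln1.
have : (minPoly 1 a %| map_poly (in_alg K) g)%R.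
  apply: minPoly_dvdp; first exact: alg_polyOver.
  rewrite /root -(fmorph_eq0 iota) -horner_map -map_poly_comp.
  rewrite (eq_map_poly (g := ratr)) ?(rootP (root_annihilator ag)) // => r /=.
  by rewrite alg_num_field fmorph_rat.
move/dvdp_leq; rewrite map_poly_eq0 => /(_ g0).
by rewrite size_minPoly size_map_poly; case: (size g).
Qed.

End NumberField.

(** * Weil heights and the Mahler measure *)

(** One of the two closed half planes carries at least half of the sum over the conjugates; real
    conjugates lie in both. The field degree is at most the number [size t] of conjugates. *)
Lemma weil_height_ge (R : realType) (a : algC) (g : {poly rat}) (t : seq R[i]) :
  annihilator a g -> g != 0 -> map_poly ratr g = \prod_(b <- t) ('X - b%:P) ->
  (((\sum_(b <- t) log_plus b) / 2 / (size t)%:R)%:E <= weil_height R a)%E.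
Proof.
rewrite /weil_height; case: num_field_exists => K [iota [[|a' [|? ?]] //= [<-] Ka]] ag g0 gt.
have ut : uniq t by rewrite -separable_prod_XsubC -gt separable_map (annihilator_separable ag).
have sgt : (size g).-1 = size t.
  by rewrite -(size_map_poly (ratr : {rmorphism rat -> R[i]})) gt size_prod_XsubC.
have K0 : 0 < (\dim {:K})%:R :> R by rewrite ltr0n adim_gt0.
have dimK : (\dim {:K})%:R <= (size t)%:R :> R.
  by rewrite ler_nat -sgt (dim_annihilator_le Ka ag).
have bound (p : pred R[i]) : {in p &, forall b c, 0 <= complex.Im b * complex.Im c} ->
    (\sum_(b <- t) log_plus b) / 2 <= \sum_(b <- t | p b) log_plus b ->
    (((\sum_(b <- t) log_plus b) / 2 / (size t)%:R)%:E <= height_in R a')%E.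
  move=> pIm le; have s0 : 0 <= \sum_(b <- t) log_plus b.
    by apply: sumr_ge0 => b _; exact: log_plus_ge0.
  apply: (@le_trans _ _ ((\sum_(b <- [seq b <- t | p b]) log_plus b) / (\dim {:K})%:R)%:E).
    rewrite lee_fin big_filter ler_pM // ?divr_ge0 ?invr_ge0 //.
    by rewrite lef_pV2 ?posrE ?K0 ?(lt_le_trans K0).
  apply: sum_log_plus_le_height_in; first exact: filter_uniq.
    move=> b; rewrite mem_filter => /andP[_ bt]; apply: (embedding_exists Ka ag).
    by rewrite gt root_prod_XsubC.
  by move=> b c; rewrite !mem_filter => /andP[pb _] /andP[pc _]; apply: pIm.
have split : \sum_(b <- t) log_plus b <=
    \sum_(b <- t | 0 <= complex.Im b) log_plus b +
    \sum_(b <- t | complex.Im b <= 0) log_plus b.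
  rewrite (big_mkcond (fun b => 0 <= complex.Im b)).
  rewrite (big_mkcond (fun b => complex.Im b <= 0)) -big_split /=.
  apply: ler_sum => b _; have := log_plus_ge0 b.
  by have [] := orP (le_total 0 (complex.Im b)) => ->; case: ifP; lra.
have [le|le] := lerP ((\sum_(b <- t) log_plus b) / 2)
  (\sum_(b <- t | 0 <= complex.Im b) log_plus b).
  by apply: (bound _ _ le) => b c /= b0 c0; apply: mulr_ge0.
apply: (bound (fun b => complex.Im b <= 0)); last lra.
by move=> b c /= b0 c0; apply: mulr_le0.
Qed.

Lemma map_poly_rat_roots (F : closedFieldType) (phi : {rmorphism rat -> F}) (q : {poly rat}) :
  q \is monic -> {s : seq F | map_poly phi q = \prod_(a <- s) ('X - a%:P)}.
Proof.
move=> qm; have [s] := closed_field_poly_normal (map_poly phi q).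
by rewrite lead_coef_map (monicP qm) rmorph1 scale1r => e; exists s.
Qed.

(** Induction on the number of roots, splitting off the minimal polynomial [g] of one of them. The
    statement is over [rat], with arbitrary lists of roots, so that it applies to the cofactor. *)
Lemma sum_weil_height_ge (R : realType) (q : {poly rat}) (s : seq algC) (t : seq R[i]) :
  q \is monic ->
  map_poly ratr q = \prod_(a <- s) ('X - a%:P) ->
  map_poly ratr q = \prod_(b <- t) ('X - b%:P) ->
  (((\sum_(b <- t) log_plus b) / 2)%:E <= \sum_(a <- s) weil_height R a)%E.
Proof.
have [n] := ubnP (size s); elim: n q s t => // n IH q s t sn qm qs qt.
have sst : size s = size t.
  apply/eqP; rewrite -eqSS -(size_prod_XsubC s id) -(size_prod_XsubC t id) -qs -qt.
  by rewrite !size_map_poly.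
case: s => [|a s] in sn qs sst *.
  by case: t sst {qt} => //; rewrite !big_nil mul0r.
have [g [_ gm ag]] := minCpolyP a.
have : root (map_poly ratr q) a by rewrite qs root_prod_XsubC mem_head.
rewrite ag => /dvdpP[k qk].
have km : k \is monic by move: qm; rewrite qk monicMr.
have [sk ksk] := map_poly_rat_roots (ratr : {rmorphism rat -> algC}) km.
have [tk ktk] := map_poly_rat_roots (ratr : {rmorphism rat -> R[i]}) km.
have [sg gsg] := map_poly_rat_roots (ratr : {rmorphism rat -> algC}) gm.
have [tg gtg] := map_poly_rat_roots (ratr : {rmorphism rat -> R[i]}) gm.
have ps : perm_eq (a :: s) (sk ++ sg).
  by apply: prod_XsubC_eq; rewrite -qs qk rmorphM /= ksk gsg big_cat.
have pt : perm_eq t (tk ++ tg).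
  by apply: prod_XsubC_eq; rewrite -qt qk rmorphM /= ktk gtg big_cat.
rewrite (perm_big _ ps) (perm_big _ pt) !big_cat /= mulrDl EFinD.
have sg0 : (0 < size sg)%N.
  have := size_annihilator ag (monic_neq0 gm).
  by rewrite -(size_map_poly (ratr : {rmorphism rat -> algC})) gsg size_prod_XsubC.
apply: leeD.
  apply: (IH k) => //; have := perm_size ps; rewrite size_cat /=.
  move=> e; rewrite -ltnS; apply: leq_ltn_trans sn.
  by rewrite /= e -[leqLHS]addn1 leq_add2l.
have sgtg : size sg = size tg.
  apply/eqP; rewrite -eqSS -(size_prod_XsubC sg id) -(size_prod_XsubC tg id) -gsg -gtg.
  by rewrite !size_map_poly.
set L := _ / 2.
(* Every root of [g] has [g] as its minimal polynomial, hence the same lower bound; the sum over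
   these [size tg] roots restores [L]. *)
apply: (@le_trans _ _ (\sum_(b <- sg) (L / (size tg)%:R)%:E)%E).
  rewrite sumEFin lee_fin big_const_seq count_predT iter_addr_0 sgtg.
  rewrite -[leRHS]mulr_natr divfK //.
  by rewrite pnatr_eq0 -sgtg; lia.
rewrite big_seq [leRHS]big_seq; apply: lee_sum => b bs.
apply: (@weil_height_ge _ _ g) => //; last exact: monic_neq0.
by apply: (annihilator_conj gm ag); rewrite gsg root_prod_XsubC.
Qed.

Lemma sum_weil_height_algC_roots (R : realType) (f : {poly int}) (t : seq R[i]) :
  f \is monic -> map_poly intr f = \prod_(b <- t) ('X - b%:P) ->
  (((\sum_(b <- t) log_plus b) / 2)%:E <= \sum_(a <- algC_roots f) weil_height R a)%E.
Proof.
move=> fm ft; apply: (@sum_weil_height_ge _ (map_poly intr f)).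
- exact: monic_map.
- rewrite -map_poly_comp (eq_map_poly (g := intr)); last by move=> z /=; rewrite rmorph_int.
  rewrite /algC_roots; case: closed_field_poly_normal => s /=.
  by rewrite lead_coef_map_inj ?(monicP fm) ?scale1r //; exact: intr_inj.
- rewrite -ft -map_poly_comp; apply: eq_map_poly => z /=; by rewrite rmorph_int.
Qed.

(** * Divisibility modulo [m] in terms of integer polynomials *)

Lemma intr_Zp_eq0 (m : nat) (c : int) : (1 < m)%N -> ((c%:~R : 'Z_m) == 0) = (m%:Z %| c)%Z.
Proof.
move=> m1; have nat_eq0 (n : nat) : ((n%:R : 'Z_m) == 0) = (m %| n)%N.
  by rewrite -val_eqE /= val_Zp_nat.
case: c => n; rewrite ?NegzE ?rmorphN ?oppr_eq0 ?dvdzN ?dvdzE //=.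
  by rewrite -?natz ?rmorph_nat nat_eq0 ?absz_nat.
by rewrite -?natz ?rmorph_nat nat_eq0 ?absz_nat.
Qed.

(** The coefficients of the cofactor are lifted to their standard representatives; what remains of
    [f] reduces to zero, so its coefficients are exactly divisible by [m]. *)
Lemma divisible_mod_lift (m n : nat) (f : {poly int}) : (1 < m)%N ->
  divisible_mod m n f ->
  exists g h, f = g * (\sum_(i < n) 'X^i) + m%:Z *: h.
Proof.
move=> m1 [g fg]; pose lift (x : 'Z_m) : int := (x : nat)%:Z.
pose g' := map_poly lift g; pose e := f - g' * \sum_(i < n) 'X^i.
exists g', (map_poly (fun c => (c %/ m%:Z)%Z) e).
apply/eqP; rewrite addrC -subr_eq -/e; apply/eqP; apply/polyP => i.
rewrite coefZ coef_map_id0 ?div0z // mulrC divzK //.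
have g'g : map_poly intr g' = g.
  apply/polyP => j; rewrite coef_map /= coef_map_id0 // /lift.
  by rewrite -[RHS]natr_Zp.
have e0 : map_poly (intr : int -> 'Z_m) e = 0.
  rewrite rmorphB rmorphM /= g'g fg rmorph_sum /=.
  by under [X in _ - _ * X]eq_bigr do rewrite map_polyXn; rewrite subrr.
by rewrite -intr_Zp_eq0 // -coef_map e0 coef0.
Qed.

(** The geometric polynomial is monic, so degrees add in the product even when ['Z_m] has zero
    divisors. *)
Lemma divisible_mod_size (m n : nat) (f : {poly int}) : (1 < m)%N ->
  f \is monic -> divisible_mod m n.+1 f -> (n < size f)%N.
Proof.
move=> m1 fm [g fg]; have m0 : (1 : 'Z_m) != 0 by rewrite oner_eq0.
have -> : size f = size (map_poly (intr : int -> 'Z_m) f).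
  by rewrite size_map_poly_id0 // (monicP fm) rmorph1.
have g0 : g != 0.
  apply: contraTneq (monic_map (intr : {rmorphism int -> 'Z_m}) fm) => g0.
  by rewrite fg g0 mul0r monicE lead_coef0 eq_sym.
rewrite fg size_Mmonic ?geometric_poly_monic // size_geometric_poly addnS /=.
by move: g0; rewrite -size_poly_gt0 => g0; rewrite -[n.+1]add1n leq_add2r.
Qed.

(** * Choice of [k] and of the constant *)

(** The bound of [log_mahler_ge] divided by [n], using [D / n <= 1 / eps] and
    [(n - 1) / n >= 1 / 2]. *)
Lemma log_plus_sum_lower (R : realType) (eps : R) (f : {poly int}) (D m n k : nat)
    (s : seq R[i]) :
  0 < eps -> f \is monic -> size f = D.+1 -> (2 <= m)%N ->
  Num.max (eps * D%:R) 2 <= n%:R :> R ->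
  divisible_mod m n f -> no_root_of_unity f ->
  map_poly intr f = \prod_(b <- s) ('X - b%:P) ->
  k.+1%:R / 2 * ln m%:R <= ln 2 / eps + (m ^ k)%:R * \sum_(b <- s) log_plus b.
Proof.
move=> e0 fm sf m2; rewrite ge_max ler_nat => /andP[eD n2] fd nru fs.
case: n => [|[|n]] // in n2 eD fd *.
have := divisible_mod_size m2 fm fd; rewrite sf ltnS => nD.
have [g [h fgh]] := divisible_mod_lift m2 fd.
case: D => [//|d] in sf nD eD *.
have := @log_mahler_ge R d n m k f g h s nD (ltnW m2) fm sf fgh nru fs.
set S := \sum_(b <- s) _; set l2 := ln 2; set lm := ln m%:R.
have l2_0 : 0 <= l2 by rewrite ln_ge0 // ler1n.
have lm_0 : 0 <= lm by rewrite ln_ge0 // ler1n ltnW.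
rewrite !natrM => main.
have n0 : 0 < n.+2%:R :> R by rewrite ltr0n.
rewrite -(ler_pM2l n0).
have De : d.+1%:R <= n.+2%:R / eps by rewrite ler_pdivlMr // mulrC.
have h1 : d.+1%:R * l2 <= n.+2%:R * (l2 / eps).
  by rewrite mulrCA mulrC ler_wpM2l // mulrC.
have h2 : n.+2%:R * (k.+1%:R / 2 * lm) <= k.+1%:R * n.+1%:R * lm.
  have -> : n.+2%:R * (k.+1%:R / 2 * lm) = (k.+1%:R * lm) * (n.+2%:R / 2) by ring.
  have -> : k.+1%:R * n.+1%:R * lm = (k.+1%:R * lm) * n.+1%:R by ring.
  apply: ler_wpM2l; first by rewrite mulr_ge0.
  by rewrite ler_pdivrMr // -natrM ler_nat; lia.
by apply: le_trans h2 (le_trans main _); rewrite mulrDr [_ * (_ * S)]mulrA lerD2r.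
Qed.

Lemma log_plus_sum_ge_log (R : realType) (eps : R) : 0 < eps ->
  exists2 C : R, 0 < C &
    forall (f : {poly int}) (D m n : nat) (s : seq R[i]),
      f \is monic -> size f = D.+1 ->
      (2 <= m)%N -> Num.max (eps * D%:R) 2 <= n%:R ->
      divisible_mod m n f -> no_root_of_unity f ->
      map_poly intr f = \prod_(b <- s) ('X - b%:P) ->
      C * ln m%:R <= (\sum_(b <- s) log_plus b) / 2.
Proof.
(* With [b >= 4 / eps] the loss [ln 2 / eps] is at most [b * ln 2 / 4]. *)
move=> e0; pose b := (Num.bound (4 / eps)).+1.
have b_gt : 4 / eps <= b%:R.
  apply: ltW; apply: lt_trans (_ : (Num.bound (4 / eps))%:R < b%:R); last by rewrite ltr_nat.
  by rewrite archi_boundP // divr_ge0 // ltW.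
have b1 : 1 <= b%:R :> R by rewrite ler1n.
pose B : R := (2 ^ (b * b))%:R.
have B1 : 1 <= B by rewrite ler1n expn_gt0.
exists (8 * b%:R * B)^-1; first by rewrite invr_gt0 !mulr_gt0 //; lra.
move=> f D m n s fm sf m2 nD fd nru fs.
have L k := log_plus_sum_lower k e0 fm sf m2 nD fd nru fs.
move: (L 0%N) (L b); set S := \sum_(_ <- _) _; set lm := ln m%:R; set l2 := ln 2.
have l2_0 : 0 < l2 by rewrite ln_gt0 // ltr1n.
have lm_0 : l2 <= lm by rewrite ler_ln ?posrE ?ltr0n ?ler_nat //; lia.
have l2e : l2 / eps <= b%:R * l2 / 4.
  have : l2 * (4 / eps) <= l2 * b%:R by rewrite ler_pM2l.
  have -> : l2 * (4 / eps) = 4 * (l2 / eps) by ring.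
  lra.
have bB1 : 1 <= b%:R * B by rewrite mulr_ege1.
rewrite expn0 mul1r => L0 Lb.
rewrite mulrC -[8 * _ * _]mulrA ler_pdivrMr; last by lra.
(* The cases are [m >= 2^b], where [k = 0] gives [S >= ln m / 4], and [m < 2^b], where [k = b] is
   used and [m^b <= B]. *)
have [big|small] := lerP (b%:R * l2) lm.
  have S4 : lm / 4 <= S by lra.
  have : lm / 4 * (b%:R * B) <= S * (b%:R * B) by rewrite ler_pM2r; lra.
  have : lm * 1 <= lm * (b%:R * B) by rewrite ler_pM2l; lra.
  lra.
have mB : (m ^ b)%:R <= B.
  rewrite /B expnM ler_nat leq_exp2r // ltnW //.
  have : lm < ln (2 ^ b)%:R by rewrite natrX lnXn ?ltr0n // -[_ *+ b]mulr_natl.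
  by rewrite /lm ltr_ln ?posrE ?ltr0n ?expn_gt0 ?ltr_nat //; lia.
(* As [ln m >= ln 2], the left side of [Lb] is at least [(b + 1) * ln 2 / 2], of which at most
   [b * ln 2 / 4] is lost. *)
have Lb' : l2 / 2 <= (m ^ b)%:R * S.
  have : b.+1%:R / 2 * l2 <= b.+1%:R / 2 * lm by rewrite ler_pM2l // divr_gt0.
  rewrite -natr1 in Lb *; nra.
have S0 : 0 <= S by apply: sumr_ge0 => z _; exact: log_plus_ge0.
have BS : l2 / 2 <= B * S by apply: le_trans Lb' _; rewrite ler_wpM2r.
have : b%:R * (l2 / 2) <= b%:R * (B * S) by rewrite ler_pM2l; lra.
nra.
Qed.

Theorem theorem2 (R : realType) :
  (forall eps : R, 0 < eps ->
    exists2 C : R, 0 < C &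
      forall (f : {poly int}) (D m n : nat),
        f \is monic -> size f = D.+1 ->
        (2 <= m)%N -> Num.max (eps * D%:R) 2 <= n%:R ->
        divisible_mod m n f ->
        no_root_of_unity f ->
        ((C * ln m%:R)%:E <= \sum_(a <- algC_roots f) weil_height R a)%E)
  /\
  (forall eps : R, 0 < eps ->
    exists2 C : R, 0 < C &
      forall f : {poly int},
        f \is monic ->
        no_root_of_unity f ->
        (exists m n : nat,
          [/\ (2 <= m)%N, Num.max (eps * (size f).-1%:R) 2 <= n%:R
            & divisible_mod m n f]) ->
        (C%:E <= \sum_(a <- algC_roots f) weil_height R a)%E).
Proof.
have main (eps : R) : 0 < eps -> exists2 C : R, 0 < C &
    forall (f : {poly int}) (D m n : nat),
      f \is monic -> size f = D.+1 ->
      (2 <= m)%N -> Num.max (eps * D%:R) 2 <= n%:R ->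
      divisible_mod m n f -> no_root_of_unity f ->
      ((C * ln m%:R)%:E <= \sum_(a <- algC_roots f) weil_height R a)%E.
  move=> /log_plus_sum_ge_log[C C0 HC]; exists C => // f D m n fm sf m2 nD fd nru.
  have [s] := closed_field_poly_normal (map_poly (intr : int -> R[i]) f).
  rewrite lead_coef_map_inj ?(monicP fm) ?scale1r //; last exact: intr_inj.
  move=> fs; apply: le_trans (sum_weil_height_algC_roots fm fs).
  by rewrite lee_fin (HC f D m n).
(* Since [m >= 2], the first part gives the second with [C * ln 2]. *)
split=> [//|eps /main[C C0 HC]]; exists (C * ln 2).
  by rewrite mulr_gt0 // ln_gt0 // ltr1n.
move=> f fm nru [m [n [m2 nD fd]]].
have sf : size f = (size f).-1.+1 by rewrite prednK // size_poly_gt0 monic_neq0.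
apply: le_trans (HC f _ m n fm sf m2 nD fd nru).
by rewrite lee_fin ler_pM2l // ler_ln ?posrE ?ltr0n ?ler_nat //; lia.
Qed.
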